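(* Let $p=\sum_\alpha c_\alpha x^\alpha\in\mathbb{R}[x_1,\dots,x_n]$, let $Q\subseteq\mathbb{Z}_+^n$ be a finite set satisfying $\mathrm{SOSS}(p,Q)$, and suppose $p$ is a split polynomial with respect to the subsets $T_1,\dots,T_u$ of $V(p,Q)$. For $i=1,\dots,u$ let $$p_i=\sum_{\alpha\in S(p),\ \psi_Q(\alpha)\subseteq T_i}c_\alpha x^\alpha .$$ Then $p$ is SOS if and only if $p_i$ is SOS for every $i=1,\dots,u$.
   Context: Polynomials have real coefficients. A polynomial $p\in\mathbb{R}[x_1,\dots,x_n]$ is SOS if $p=\sum_{i=1}^s q_i^2$ for some finitely many $q_1,\dots,q_s\in\mathbb{R}[x_1,\dots,x_n]$. $\mathbb{Z}_+$ is the set of non-negative integers. The support $S(p)\subseteq\mathbb{Z}_+^n$ of $p=\sum_\alpha c_\alpha x^\alpha$ is the set of exponent vectors with nonzero coefficient. A set $Q\subseteq\mathbb{Z}_+^n$ satisfies the relation $\mathrm{SOSS}(p,Q)$ if: whenever $p$ is SOS, there exist $q_1,\dots,q_s$ with $p=\sum_{i=1}^s q_i^2$ and $S(q_i)\subseteq Q$ for all $i$. $Q+Q$ is the Minkowski sum. For $\alpha\in Q+Q$ let $\varphi_Q(\alpha)=\{\beta\in Q\mid \exists\gamma\in Q,\ \beta+\gamma=\alpha\}$. For $Q$ satisfying $\mathrm{SOSS}(p,Q)$ let $V(p,Q)=\{\alpha\in Q\mid \varphi_Q(2\alpha)=\{\alpha\}\}$. The map $\psi_Q$ assigns to each vector $\alpha$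 a subset of $V(p,Q)$: $\psi_Q(\alpha)=\emptyset$ if $\alpha\notin Q+Q$, and for $\alpha\in Q+Q$, $$\psi_Q(\alpha)=\begin{cases}\{\tfrac12\alpha\} & \text{if }\varphi_Q(\alpha)=\{\tfrac12\alpha\},\\ \bigcup_{\beta,\gamma\in Q,\ \beta\neq\gamma,\ \beta+\gamma=\alpha}\bigl(\psi_Q(2\beta)\cup\psi_Q(2\gamma)\bigr) & \text{otherwise,}\end{cases}$$ where $(\psi_Q(\alpha))_\alpha$ is the least family (with respect to inclusion) satisfying these equations. For $T\subseteq V(p,Q)$ let $\sigma(T)=\{\gamma\in Q\mid \psi_Q(2\gamma)\subseteq T\}$. Split polynomial: let $Q$ be a finite set satisfying $\mathrm{SOSS}(p,Q)$. If $T_1,\dots,T_u$ are pairwise disjoint nonempty subsets of $V(p,Q)$ such that (1) for every $i=1,\dots,u$, $\psi_Q(\alpha+\beta)\subseteq T_i$ for all $\alpha,\beta\in\sigma(T_i)$, and (2) for every $\alpha\in S(p)$ there exists exactly one $T_i$ with $\psi_Q(\alpha)\subseteq T_i$, then $p$ is called a split polynomial with respect to $T_1,\dots,T_u$. *)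

(* Defs.v *)
From HB Require Import structures.
From mathcomp Require Import all_boot all_order all_algebra.
From mathcomp Require Import finmap mpoly.
From mathcomp Require Import boolp reals.

Set Implicit Arguments.
Unset Strict Implicit.
Unset Printing Implicit Defensive.

Import GRing.Theory.

Local Open Scope ring_scope.
Local Open Scope fset_scope.

Definition SOS (n : nat) (R : realType) (p : {mpoly R[n]}) : Prop :=
  exists qs : seq {mpoly R[n]}, p = \sum_(q <- qs) q ^+ 2.

Definition SOSS (n : nat) (R : realType) (p : {mpoly R[n]})
    (Q : {pred 'X_{1..n}}) : Prop :=
  SOS p ->
  exists2 qs : seq {mpoly R[n]},
    p = \sum_(q <- qs) q ^+ 2 & forall q, q \in qs -> {subset msupp q <= Q}.

Definition minkowski (n : nat) (A B : {fset 'X_{1..n}}) : {fset 'X_{1..n}} :=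
  [fset (a + b)%MM | a in A, b in B].

Definition phi (n : nat) (Q : {fset 'X_{1..n}}) (alpha : 'X_{1..n}) :
    {fset 'X_{1..n}} :=
  [fset beta in Q | [exists gamma : Q, (beta + val gamma)%MM == alpha]].

(* The set V(p, Q): it depends on p only through the requirement SOSS p Q. *)
Definition V (n : nat) (Q : {fset 'X_{1..n}}) : {fset 'X_{1..n}} :=
  [fset alpha in Q | phi Q (alpha *+ 2)%MM == [fset alpha]].

(* The equations defining psi_Q, for a family f of subsets of V Q.  Writing
   alpha = 2 beta replaces beta = alpha / 2, which need not be integral. *)
Definition psi_system (n : nat) (Q : {fset 'X_{1..n}})
    (f : 'X_{1..n} -> {fset 'X_{1..n}}) : Prop :=
  [/\ forall alpha : 'X_{1..n}, f alpha `<=` V Q,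
      forall alpha : 'X_{1..n}, alpha \notin minkowski Q Q -> f alpha = fset0,
      forall alpha beta : 'X_{1..n}, alpha \in minkowski Q Q ->
        alpha = (beta *+ 2)%MM ->
        phi Q alpha = [fset beta] -> f alpha = [fset beta]
    & forall alpha : 'X_{1..n}, alpha \in minkowski Q Q ->
        (forall beta, alpha = (beta *+ 2)%MM -> phi Q alpha <> [fset beta]) ->
        f alpha =
          \bigcup_(beta <- Q)
           \bigcup_(gamma <- Q | (beta != gamma) && ((beta + gamma)%MM == alpha))
              (f (beta *+ 2)%MM `|` f (gamma *+ 2)%MM)].

(* The least solution of psi_system, as the intersection of all solutions;
   psiP and psi_min show that it is itself a solution and below every other. *)
Definition psi (n : nat) (Q : {fset 'X_{1..n}}) (alpha : 'X_{1..n}) :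
    {fset 'X_{1..n}} :=
  [fset delta in V Q | `[< forall f, psi_system Q f -> delta \in f alpha >]].

Definition sigma (n : nat) (Q T : {fset 'X_{1..n}}) : {fset 'X_{1..n}} :=
  [fset gamma in Q | psi Q (gamma *+ 2)%MM `<=` T].

Definition split_poly (n : nat) (R : realType) (p : {mpoly R[n]})
    (Q : {fset 'X_{1..n}}) (u : nat) (T : 'I_u -> {fset 'X_{1..n}}) : Prop :=
  [/\ forall i, T i `<=` V Q /\ T i != fset0,
      forall i j, i != j -> [disjoint T i & T j],
      forall (i : 'I_u) (alpha beta : 'X_{1..n}),
        alpha \in sigma Q (T i) -> beta \in sigma Q (T i) ->
        psi Q (alpha + beta)%MM `<=` T i
    & forall alpha : 'X_{1..n}, alpha \in msupp p ->
        exists! i, psi Q alpha `<=` T i].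

Definition split_part (n : nat) (R : realType) (p : {mpoly R[n]})
    (Q T : {fset 'X_{1..n}}) : {mpoly R[n]} :=
  \sum_(alpha <- msupp p | psi Q alpha `<=` T) p@_alpha *: 'X_[alpha].

(* delta \in psi Q alpha as an inductive predicate; used only to prove psiP. *)
Inductive psi_rel (n : nat) (Q : {fset 'X_{1..n}}) :
    'X_{1..n} -> 'X_{1..n} -> Prop :=
| psi_rel_half delta :
    phi Q (delta *+ 2)%MM = [fset delta] -> psi_rel Q (delta *+ 2)%MM delta
| psi_rel_sum (beta gamma delta : 'X_{1..n}) :
    beta \in Q -> gamma \in Q -> beta != gamma ->
    psi_rel Q (beta *+ 2)%MM delta \/ psi_rel Q (gamma *+ 2)%MM delta ->
    psi_rel Q (beta + gamma)%MM delta.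

Lemma minkowskiP (n : nat) (A B : {fset 'X_{1..n}}) (m : 'X_{1..n}) :
  reflect (exists a b, [/\ a \in A, b \in B & m = (a + b)%MM])
          (m \in minkowski A B).
Proof.
apply: (iffP idP) => [/imfset2P[a /= aA [b /= bB ->]]|[a [b [aA bB ->]]]].
  by exists a, b.
by apply/imfset2P; exists a => //; exists b.
Qed.

Lemma phiP (n : nat) (Q : {fset 'X_{1..n}}) (alpha beta : 'X_{1..n}) :
  reflect (beta \in Q /\ exists2 gamma, gamma \in Q & (beta + gamma)%MM = alpha)
          (beta \in phi Q alpha).
Proof.
rewrite !inE /=; apply: (iffP andP) => -[bQ].
  by case/existsP=> g /eqP <-; split=> //; exists (val g) => //; apply: valP.
case=> g gQ <-; split=> //.
by apply/existsP; exists [` gQ].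
Qed.

Lemma psi_rel_V (n : nat) (Q : {fset 'X_{1..n}}) alpha delta :
  psi_rel Q alpha delta -> delta \in V Q.
Proof.
have aux d : phi Q (d *+ 2)%MM = [fset d] -> d \in V Q.
  move=> e; rewrite !inE /= e eqxx andbT.
  by have /phiP[] : d \in phi Q (d *+ 2)%MM by rewrite e inE.
move: alpha delta; fix IH 3 => alpha delta [d /aux //|b g d _ _ _ [] /IH //].
Qed.

Lemma psi_rel_min (n : nat) (Q : {fset 'X_{1..n}}) f alpha delta :
  psi_system Q f -> psi_rel Q alpha delta -> delta \in f alpha.
Proof.
move=> [_ _ f1 f2]; move: alpha delta.
have in2 d : phi Q (d *+ 2)%MM = [fset d] -> (d *+ 2)%MM \in minkowski Q Q.
  move=> e; have /phiP[dQ [g gQ <-]] : d \in phi Q (d *+ 2)%MM by rewrite e inE.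
  by apply/minkowskiP; exists d, g.
fix IH 3 => alpha delta [d e|b g d bQ gQ bg h].
  by rewrite (f1 _ _ (in2 _ e) erefl e) inE.
rewrite f2; first last.
- move=> m _ e; case/negP: bg.
  have /phiP: b \in Q /\ exists2 c, c \in Q & (b + c)%MM = (b + g)%MM.
    by split=> //; exists g.
  have /phiP: g \in Q /\ exists2 c, c \in Q & (g + c)%MM = (b + g)%MM.
    by split=> //; exists b => //; rewrite addmC.
  by rewrite e !inE => /eqP-> /eqP->.
- by apply/minkowskiP; exists b, g.
apply/bigfcupP; exists b; rewrite ?bQ //.
apply/bigfcupP; exists g; rewrite ?gQ ?bg ?eqxx // inE.
by apply/orP; case: h => /IH; [left|right].
Qed.

Lemma psi_rel_system (n : nat) (Q : {fset 'X_{1..n}}) :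
  psi_system Q (fun alpha => [fset delta in V Q | `[< psi_rel Q alpha delta >]]).
Proof.
have relE a d : (d \in [fset x in V Q | `[< psi_rel Q a x >]]) <-> psi_rel Q a d.
  rewrite inE /=; split=> [/andP[_ /asboolP]|r] //.
  by rewrite unfold_in /= (psi_rel_V r); apply/asboolP.
have dblI (b c : 'X_{1..n}) : (b *+ 2)%MM = (c *+ 2)%MM -> b = c.
  move/mnmP=> e; apply/mnmP=> i; have := e i.
  by rewrite !mulmnE => /eqP; rewrite eqn_pmul2r // => /eqP.
split.
- by move=> a; apply/fsubsetP => d /relE /psi_rel_V.
- move=> a aN; apply/fsetP => d; rewrite [RHS]in_fset0; apply/negP => /relE r.
  case: r aN => [e he|b g e bQ gQ _ _] /minkowskiP[].
    have /phiP[eQ [g gQ <-]] : e \in phi Q (e *+ 2)%MM by rewrite he inE.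
    by exists e, g.
  by exists b, g.
- move=> a b _ -> e; apply/fsetP => d; rewrite [RHS]in_fset1; apply/idP/eqP => [/relE r|->].
    suff gen m : psi_rel Q m d -> m = (b *+ 2)%MM -> d = b by apply: gen r _.
    case=> [c _ /dblI //|b' g' d' b'Q g'Q b'g' _ em].
    case/negP: b'g'.
    have /phiP: b' \in Q /\ exists2 c, c \in Q & (b' + c)%MM = (b' + g')%MM.
      by split=> //; exists g'.
    have /phiP: g' \in Q /\ exists2 c, c \in Q & (g' + c)%MM = (b' + g')%MM.
      by split=> //; exists b' => //; rewrite addmC.
    by rewrite em e !inE => /eqP-> /eqP->.
  by apply/relE; constructor.
- move=> a aQ nhalf; apply/fsetP => d; apply/idP/idP.
    move/relE=> r; case: r nhalf {aQ} => [c hc /(_ c erefl) //|b g d' bQ gQ bg h _].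
    apply/bigfcupP; exists b; rewrite ?bQ //.
    apply/bigfcupP; exists g; rewrite ?gQ ?bg ?eqxx //.
    by apply/fsetUP; case: h => /relE; [left|right].
  case/bigfcupP=> b /andP[bQ _] /bigfcupP[g /andP[gQ /andP[bg /eqP <-]]] h.
  apply/relE; apply: psi_rel_sum => //.
  by case/fsetUP: h => /relE; [left|right].
Qed.

Lemma psi_relP (n : nat) (Q : {fset 'X_{1..n}}) alpha :
  psi Q alpha = [fset delta in V Q | `[< psi_rel Q alpha delta >]].
Proof.
apply/fsetP => d; rewrite !inE /=; congr (_ && _); apply/asboolP/asboolP => h.
  have := h _ (psi_rel_system Q).
  by rewrite !inE /= => /andP[_ /asboolP].
by move=> f fs; apply: psi_rel_min h.
Qed.

Lemma psiP (n : nat) (Q : {fset 'X_{1..n}}) : psi_system Q (psi Q).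
Proof. by rewrite (funext (@psi_relP n Q)); apply: psi_rel_system. Qed.

Lemma psi_min (n : nat) (Q : {fset 'X_{1..n}}) f :
  psi_system Q f -> forall alpha, psi Q alpha `<=` f alpha.
Proof.
by move=> fs a; apply/fsubsetP => d; rewrite !inE /= => /andP[_ /asboolP/(_ f fs)].
Qed.

(* Main.v *)
Require Import Defs.
From mathcomp Require Import all_boot all_order all_algebra.
From mathcomp Require Import finmap mpoly.
From mathcomp Require Import boolp reals.

(** The proof turns on one equivalence, for exponents [b], [c] in [Q]:
    [psi Q (b + c) `<=` T i] exactly when [b] and [c] both lie in
    [sigma Q (T i)].  From right to left this is the closure
    condition on [sigma Q (T i)] in the definition of a split polynomial; from
    left to right it is the recursion for [psi], by which [psi Q (b + c)]
    contains [psi Q (2 b)] and [psi Q (2 c)] ([psi_add_sub_sigma]).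

    Call an exponent [m] selected when [psi Q m `<=` T i], so that
    [split_part p Q (T i)] keeps the selected terms of [p].  If [q] is supported
    in [Q], the equivalence says that a product of two terms of [q] is selected
    if and only if both factors have exponents in [sigma Q (T i)].  Hence keeping
    the selected terms of [q ^+ 2] amounts to squaring the part of [q] supported
    in [sigma Q (T i)] ([mrestrM]), and by linearity a decomposition
    [p = \sum q ^+ 2] with supports in [Q] restricts to a decomposition of
    [split_part p Q (T i)].

    Conversely, each term of a split polynomial [p] is selected for exactly one
    index [i], so [p] is the sum of its parts ([split_part_sum]) and is SOS as
    soon as they are. *)

Import GRing.Theory.
Local Open Scope ring_scope.
Local Open Scope fset_scope.

Definition mrestr {n : nat} {R : realType} (P : {pred 'X_{1..n}})
    (p : {mpoly R[n]}) : {mpoly R[n]} :=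
  \sum_(m <- msupp p | P m) p@_m *: 'X_[m].

Lemma mcoeff_mrestr (n : nat) (R : realType) (P : {pred 'X_{1..n}})
    (p : {mpoly R[n]}) (m : 'X_{1..n}) :
  (mrestr P p)@_m = if P m then p@_m else 0.
Proof.
rewrite /mrestr linear_sum /=.
have coefE k : (p@_k *: 'X_[k] : {mpoly R[n]})@_m = p@_k *+ (k == m).
  by rewrite mcoeffZ mcoeffX mulr_natr.
under eq_bigr do rewrite coefE.
have [mp|mp] := boolP (m \in msupp p); last first.
  rewrite (memN_msupp_eq0 mp) if_same big_seq_cond big1 // => k /andP[kp _].
  by case: eqVneq kp mp => [-> ->|_ _ _]; rewrite ?mulr0n.
rewrite big_mkcond (bigD1_seq m) //= eqxx mulr1n big1 ?addr0 // => k /negbTE->.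
by rewrite mulr0n if_same.
Qed.

Lemma mrestr_sum (n : nat) (R : realType) (P : {pred 'X_{1..n}})
    (ps : seq {mpoly R[n]}) :
  mrestr P (\sum_(p <- ps) p) = \sum_(p <- ps) mrestr P p.
Proof.
apply/mpolyP => m; rewrite mcoeff_mrestr !linear_sum /=.
under [RHS]eq_bigr do rewrite mcoeff_mrestr.
by case: (P m) => [|]; last rewrite big1.
Qed.

(** Restriction is not multiplicative in general; it is when membership of a
    sum of exponents in [P] is decided by the two summands separately. *)
Lemma mrestrM (n : nat) (R : realType) (Q P S : {pred 'X_{1..n}})
    (p q : {mpoly R[n]}) :
  {in Q &, forall b c, P (b + c)%MM = S b && S c} ->
  {subset msupp p <= Q} -> {subset msupp q <= Q} ->
  mrestr P (p * q) = mrestr S p * mrestr S q.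
Proof.
move=> PS pQ qQ; apply/mpolyP => m; rewrite mcoeff_mrestr !mcoeffM.
rewrite (_ : (if P m then _ else 0) =
   \sum_(k : 'X_{1..n < (mdeg m).+1, (mdeg m).+1} | m == (k.1 + k.2)%MM)
     (if P m then p@_k.1 * q@_k.2 else 0)); last by case: (P m) => [|]; last rewrite big1.
apply: eq_bigr => -[b c] /= /eqP em; rewrite !mcoeff_mrestr.
have -> : P m = P (b + c)%MM by congr (P _).
have [bp|/memN_msupp_eq0->] := boolP (bmnm b \in msupp p); last first.
  by rewrite mul0r !if_same mul0r.
have [cq|/memN_msupp_eq0->] := boolP (bmnm c \in msupp q); last first.
  by rewrite mulr0 !if_same mulr0.
rewrite (PS _ _ (pQ _ bp) (qQ _ cq)).
by case: (S b); case: (S c); rewrite ?mul0r ?mulr0.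
Qed.

Lemma psi_double_sub (n : nat) (Q : {fset 'X_{1..n}}) (b c : 'X_{1..n}) :
  b \in Q -> c \in Q -> psi Q (b *+ 2)%MM `<=` psi Q (b + c)%MM.
Proof.
move=> bQ cQ; have [<-|bc] := eqVneq b c; first exact: fsubset_refl.
apply/fsubsetP => d; rewrite !psi_relP !inE => /andP[-> /asboolP bd] /=.
by apply/asboolP/psi_rel_sum => //; left.
Qed.

(** Because the recursion for [psi Q] runs over all decompositions of an
    exponent, the single decomposition [b + c] forces both summands into
    [sigma Q T]; so a selected exponent has no decomposition that leaves
    [sigma Q T], which is what rules out cross terms. *)
Lemma psi_add_sub_sigma (n : nat) (Q T : {fset 'X_{1..n}}) (b c : 'X_{1..n}) :
  b \in Q -> c \in Q -> psi Q (b + c)%MM `<=` T ->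
  b \in sigma Q T /\ c \in sigma Q T.
Proof.
move=> bQ cQ bcT; rewrite !inE /= bQ cQ /=.
split; apply: fsubset_trans bcT; first exact: psi_double_sub.
by rewrite addmC psi_double_sub.
Qed.

Lemma split_part_sum (n : nat) (R : realType) (p : {mpoly R[n]})
    (Q : {fset 'X_{1..n}}) (u : nat) (T : 'I_u -> {fset 'X_{1..n}}) :
  (forall alpha, alpha \in msupp p -> exists! i, psi Q alpha `<=` T i) ->
  p = \sum_(i < u) split_part p Q (T i).
Proof.
move=> T1; apply/mpolyP => m; rewrite linear_sum /=.
under eq_bigr do rewrite (mcoeff_mrestr _ _ (fun a => psi Q a `<=` T _)).
have [/T1[i [iT iU]]|/memN_msupp_eq0->] := boolP (m \in msupp p); last first.
  by rewrite big1 // => i _; rewrite if_same.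
rewrite (bigD1 i) //= iT big1 ?addr0 // => j ji.
by case: ifP => // /iU ij; rewrite ij eqxx in ji.
Qed.

Lemma SOS_sum (n : nat) (R : realType) (I : Type) (r : seq I)
    (F : I -> {mpoly R[n]}) :
  (forall i, SOS (F i)) -> SOS (\sum_(i <- r) F i).
Proof.
move=> FS; apply: big_ind => [|p q [ps ->] [qs ->]|//].
  by exists [::]; rewrite big_nil.
by exists (ps ++ qs); rewrite big_cat.
Qed.

Theorem theorem4 (R : realType) (n : nat) (p : {mpoly R[n]})
    (Q : {fset 'X_{1..n}}) (u : nat) (T : 'I_u -> {fset 'X_{1..n}}) :
  SOSS p (mem Q) ->
  split_poly p Q T ->
  SOS p <-> (forall i : 'I_u, SOS (split_part p Q (T i))).
Proof.
move=> pQ [_ _ Tadd T1]; split=> [/pQ[qs def_p qsQ] i|pS]; last first.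
  by rewrite (split_part_sum _ _ _ _ _ _ T1); apply: SOS_sum.
pose P : {pred 'X_{1..n}} := fun a => psi Q a `<=` T i.
pose S : {pred 'X_{1..n}} := fun a => a \in sigma Q (T i).
have PS : {in mem Q &, forall b c, P (b + c)%MM = S b && S c}.
  move=> b c bQ cQ; apply/idP/andP => [|[]]; last exact: Tadd.
  exact: psi_add_sub_sigma.
exists [seq mrestr S q | q <- qs].
rewrite -[split_part _ _ _]/(mrestr P p) def_p.
rewrite -(big_map (fun q => q ^+ 2) xpredT id) mrestr_sum !big_map.
apply: eq_big_seq => q /qsQ qQ.
by rewrite !expr2; exact: (mrestrM _ _ _ _ _ _ _ PS).
Qed.
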